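(* Let $E,F$ be real normed spaces with $\mathfrak{c}<\dim E<\dim F$, and let $m$ be a positive integer. Then the set $\mathcal{NL}(^{m}E;F)$ is $(\gamma,2^{\dim E})$-lineable in $L(^{m}E;F)$ for every cardinal $\gamma<\dim E$.
   Context: $\mathfrak{c}$ denotes the cardinality of the continuum. For a vector space $V$, $\dim V$ denotes its algebraic (Hamel) dimension, a cardinal number. For real normed spaces $E,F$ and a positive integer $m$, $L(^{m}E;F)$ is the vector space of all $m$-linear operators $E\times\cdots\times E\to F$ ($m$ factors, continuous or not), and $\mathcal{NL}(^{m}E;F)\subset L(^{m}E;F)$ is the set of all non-continuous ones. For a cardinal $\beta$, a subset $A$ of a vector space $V$ is $\beta$-lineable in $V$ if $A\cup\{0\}$ contains a $\beta$-dimensional linear subspace of $V$. For cardinals $\alpha<\beta$, $A$ is $(\alpha,\beta)$-lineable in $V$ if $A$ is $\alpha$-lineable in $V$ and for every linear subspace $W_\alpha\subset V$ with $W_\alpha\subset A\cup\{0\}$ and $\dim W_\alpha=\alpha$ there is a linear subspace $W_\beta\subset V$ with $\dim W_\beta=\beta$ and $W_\alpha\subset W_\beta\subset A\cup\{0\}$. *)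

(* Defs.v *)
From HB Require Import structures.
From mathcomp Require Import all_boot all_order all_algebra finmap.
From mathcomp Require Import all_classical all_reals all_analysis.

Set Implicit Arguments.
Unset Strict Implicit.
Unset Printing Implicit Defensive.

Import Order.TTheory GRing.Theory Num.Theory.
Import numFieldNormedType.Exports.

Local Open Scope classical_set_scope.
Local Open Scope card_scope.
Local Open Scope ring_scope.

(* A cardinal is represented by an arbitrary type of that cardinality, up to  *)
(* equipotence; 2 ^ kappa is then represented by [set kappa].                 *)
Definition card_lt (kappa lambda : Type) : bool :=
  ([set: kappa] #<= [set: lambda]) && ~~ ([set: lambda] #<= [set: kappa]).

Section Dimension.
Variables (K : fieldType) (V : lmodType K).
Implicit Types (B W : set V).

Definition lin_subspace W : Prop := submod_closed (mem W).

Definition lin_indep B : Prop :=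
  forall (s : {fset V}) (c : V -> K), [set` s] `<=` B ->
    \sum_(v <- s) c v *: v = 0 -> forall v, v \in s -> c v = 0.

Definition lin_span B : set V :=
  [set w | exists (s : {fset V}) (c : V -> K),
     [set` s] `<=` B /\ w = \sum_(v <- s) c v *: v].

Definition hamel_basis W B : Prop := lin_indep B /\ lin_span B = W.

Definition has_dim W (kappa : Type) : Prop :=
  exists2 B : set V, hamel_basis W B & B #= [set: kappa].

Definition lineable (beta : Type) (A : set V) : Prop :=
  exists W, [/\ lin_subspace W, has_dim W beta & W `<=` A `|` [set 0]].

Definition lineable2 (alpha beta : Type) (A : set V) : Prop :=
  [/\ card_lt alpha beta, lineable alpha A &
      forall Wa, lin_subspace Wa -> Wa `<=` A `|` [set 0] -> has_dim Wa alpha ->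
      exists Wb, [/\ lin_subspace Wb, has_dim Wb beta, Wa `<=` Wb &
                     Wb `<=` A `|` [set 0]]].

End Dimension.

Section MultilinearMaps.
Variables (K : fieldType) (m : nat) (E F : lmodType K).

Definition multilinear (f : ('I_m -> E) -> F) : Prop :=
  forall (i : 'I_m) (x : 'I_m -> E),
    linear (fun t : E => f (@dfwith _ (fun=> E) x i t)).

Definition multilinear_pred : {pred ('I_m -> E) -> F} :=
  fun f => `[< multilinear f >].

Lemma multilinear_submod_closed : submod_closed multilinear_pred.
Proof.
split; first by apply/asboolP => i x a u v; rewrite /= scaler0 addr0.
move=> a f g /asboolP fL /asboolP gL; apply/asboolP => i x b u v.
have afgE y : (a *: f + g) y = a *: f y + g y by [].
have /= fE := fL i x b u v; have /= gE := gL i x b u v.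
rewrite /= !afgE fE gE !scalerDr !scalerA [a * b]mulrC -!addrA.
by congr (_ + _); rewrite addrCA.
Qed.

HB.instance Definition _ :=
  GRing.isSubmodClosed.Build K (('I_m -> E) -> F) multilinear_pred
    multilinear_submod_closed.

Record mlin : Type := MLin {
  mlin_fun :> ('I_m -> E) -> F ;
  mlin_funP : mlin_fun \in multilinear_pred }.

HB.instance Definition _ := [isSub for mlin_fun].
HB.instance Definition _ := [Choice of mlin by <:].
HB.instance Definition _ := [SubChoice_isSubLmodule of mlin by <:].

End MultilinearMaps.

(* On the finite power E ^ m, the topology of pointwise convergence is the    *)
(* product topology, i.e. the norm topology.                                  *)
Definition noncontinuous_mlin (R : realType) (m : nat)
    (E F : normedModType R) : set (mlin m E F) :=
  [set f : mlin m E F | ~ continuous (f : {ptws 'I_m -> E} -> F)].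
Arguments noncontinuous_mlin {R} m E F.

(* Main.v *)
Require Import Defs.
From HB Require Import structures.
From mathcomp Require Import all_boot all_order all_algebra finmap.
From mathcomp Require Import all_classical all_reals all_analysis.

Set Implicit Arguments.
Unset Strict Implicit.
Unset Printing Implicit Defensive.

Import Order.TTheory GRing.Theory Num.Theory.
Import numFieldNormedType.Exports.

Local Open Scope classical_set_scope.
Local Open Scope card_scope.
Local Open Scope ring_scope.

(** Let C be the subspace of continuous maps in V = L(^m E; F). A subspace W is
    contained in NL U {0} iff it meets C trivially, and then a basis of W is
    linearly independent modulo C and extends to a maximal such set G, so that
    V = C + span G. If V / C has at least 2^dim E elements, every class is a
    finite linear combination of elements of G, so 2^dim E <= max (|G|, c) and
    |G| >= 2^dim E since c < 2^dim E; a subset of G of size 2^dim E containing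
    the basis of W spans the required extension.

    For the bound on V / C, cut dim E elements of a Hamel basis of E into dim E
    infinite sequences. Each set A of sequences gives a linear functional phi_A
    that is unbounded on the sequences in A and vanishes on the others, and
    (x_1, ..., x_m) |-> phi_A(x_1) psi(x_2) ... psi(x_m) y is multilinear; two
    different sets A give maps whose difference is discontinuous. *)

(** * Cardinals *)

(** Choice picks a related element of [B] for each element of [A], and the second hypothesis makes
    the choice injective. Cardinals can thus be compared through relations rather than explicit
    maps. *)
Lemma card_le_rel (T U : Type) (A : set T) (B : set U) (G : T -> U -> Prop) :
  (forall a, A a -> exists2 b, B b & G a b) ->
  (forall a a' b, G a b -> G a' b -> a = a') -> A #<= B.
Proof.
move=> Gtot Ginj.
have /choice[f fP] : forall a : A, exists b : B, G (val a) (val b).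
  move=> a; have [b Bb Gab] := Gtot _ (set_valP a).
  by exists (SigSub (mem_set Bb)).
apply/card_leP/injfunPex; exists f => // a a' _ _ ff'.
by apply: val_inj; apply: (Ginj _ _ _ (fP a)); rewrite ff'; exact: fP.
Qed.

Lemma inj_card_leT (T U : Type) (f : T -> U) :
  injective f -> [set: T] #<= [set: U].
Proof.
move=> fI; apply: (@card_le_rel _ _ _ _ (fun a b => f a = b)).
  by move=> a _; exists (f a).
by move=> a a' b <- /fI.
Qed.

Lemma card_leT_inj (T U : Type) :
  [set: T] #<= [set: U] -> exists f : T -> U, injective f.
Proof.
move=> /card_leP[f]; exists (fun a => val (f (SigSub (mem_set (I : setT a))))).
move=> a a' /val_inj faa'.
by have /(congr1 val) := @inj _ _ _ f _ _ (in_setT _) (in_setT _) faa'.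
Qed.

Lemma card_le_inj (T : Type) (U : pointedType) (A : set T) (B : set U) :
  A #<= B -> exists2 f : T -> U, (forall a, A a -> B (f a)) &
    (forall a a', A a -> A a' -> f a = f a' -> a = a').
Proof.
move=> /pcard_leP[f]; exists f => [a Aa|a a' Aa Aa']; first exact: (@funS _ _ _ _ f).
by apply: (@inj _ _ _ f); rewrite inE.
Qed.

Lemma Zorn_above (T : Type) (P : set (set T)) (A0 : set T) :
  P A0 ->
  (forall F : set (set T), F `<=` P -> F !=set0 -> total_on F subset ->
    P (\bigcup_(X in F) X)) ->
  exists A, [/\ P A, A0 `<=` A & forall B, P B -> A `<=` B -> B = A].
Proof.
move=> PA0 Pchain.
(* [Zorn_bigcup] also ranges over the empty chain, whose union is empty, so [Q] admits the empty set
   besides the members of [P] above [A0]. *)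
pose Q (X : set T) := X = set0 \/ (P X /\ A0 `<=` X).
have [F FQ Ftot|A [QA Amax]] := @Zorn_bigcup T Q.
  have [allF|] := pselect (forall X, F X -> X = set0).
    by left; rewrite bigcup0.
  move=> /existsNP[X1 /not_implyP[FX1 X1N0]].
  have UE : \bigcup_(X in F) X = \bigcup_(X in F `&` [set X | X <> set0]) X.
    apply/seteqP; split=> x [X /=]; last by move=> [FX _] Xx; exists X.
    by move=> FX Xx; exists X => //; split=> // X0; rewrite X0 in Xx.
  right; rewrite UE; split.
    apply: Pchain; first by move=> X [/FQ[|[]]].
      by exists X1.
    by move=> X Y [FX _] [FY _]; exact: Ftot.
  have [//|[_ A0X1]] := FQ _ FX1.
  by move=> x /A0X1 X1x; exists X1.
have [PA A0A] : P A /\ A0 `<=` A.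
  (* If the maximal set is empty, it must equal [A0], since [A0] itself satisfies [Q]. *)
  have [A0E|//] := QA.
  suff -> : A = A0 by split.
  apply: contrapT => AneA0; apply: (Amax A0); last by right; split.
  by rewrite properEneq; split; [exact/eqP|rewrite A0E].
exists A; split=> // B PB AB; apply: contrapT => BneA.
apply: (Amax B); first by rewrite properEneq; split=> //; apply/eqP => /esym.
by right; split=> //; exact: subset_trans A0A AB.
Qed.

(** Through this lemma, conditions that involve finitely many points at a time pass to unions of
    chains. *)
Lemma chain_mem_seq (T : eqType) (F : set (set T)) (s : seq T) :
  F !=set0 -> total_on F subset ->
  (forall x, x \in s -> (\bigcup_(X in F) X) x) ->
  exists2 X, F X & forall x, x \in s -> X x.
Proof.
move=> [X0 FX0] Ftot; elim: s => [_|x s IHs xsF]; first by exists X0.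
have [|X FX sX] := IHs; first by move=> y ys; apply: xsF; rewrite inE ys orbT.
have [Y FY Yx] := xsF _ (mem_head _ _).
have [XY|YX] := Ftot _ _ FX FY; [exists Y => // | exists X => //];
  by move=> y; rewrite inE => /predU1P[->//|/sX]; auto.
Qed.

(** Zorn's lemma gives a maximal graph of a partial injection from [A] to [B]. Were some [a0] and
    some [b] both unmatched, the pair [(a0, b)] could be added, so one side is exhausted. *)
Lemma card_le_total (T U : Type) (A : set T) (B : set U) :
  A #<= B \/ B #<= A.
Proof.
pose P (G : set (T * U)) := [/\ G `<=` A `*` B,
  (forall a b b', G (a, b) -> G (a, b') -> b = b') &
  (forall a a' b, G (a, b) -> G (a', b) -> a = a')].
have [||G [[GAB Gfun Ginj] _ Gmax]] := @Zorn_above _ P set0.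
- by split.
- move=> F FP F0 Ftot; split.
  + by move=> p [X FX Xp]; have [XAB _ _] := FP _ FX; exact: XAB.
  + move=> a b b' [X FX Xab] [Y FY Yab'].
    by have [XY|YX] := Ftot _ _ FX FY;
      [have [_ + _] := FP _ FY|have [_ + _] := FP _ FX]; apply; eauto.
  + move=> a a' b [X FX Xab] [Y FY Yab'].
    by have [XY|YX] := Ftot _ _ FX FY;
      [have [_ _ +] := FP _ FY|have [_ _ +] := FP _ FX]; apply; eauto.
have [Atot|] := pselect (forall a, A a -> exists2 b, B b & G (a, b)).
  by left; apply: (card_le_rel Atot).
move=> /existsNP[a0 /not_implyP[Aa0 /forall2NP a0G]].
right; apply: (@card_le_rel _ _ _ _ (fun b a => G (a, b))); last first.
  by move=> b b' a; exact: Gfun.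
move=> b Bb; apply: contrapT => /forall2NP bG.
have a0N b' : ~ G (a0, b').
  by move=> Gab; have [_ Bb'] := GAB _ Gab; have [] := a0G b'.
have bN a : ~ G (a, b).
  by move=> Gab; have [Aa _] := GAB _ Gab; have [] := bG a.
suff GE : G `|` [set (a0, b)] = G.
  by apply: (a0N b); rewrite -GE; right.
apply: Gmax; last by left.
split.
- by move=> p [/GAB//|->].
- move=> a b1 b2 [Gab|[-> ->]] [Gab'|]; first exact: Gfun Gab Gab'.
  + by move=> [aE _]; rewrite aE in Gab; have := a0N _ Gab.
  + by have := a0N _ Gab'.
  + by move=> [].
- move=> a a' b1 [Gab|[-> ->]] [Gab'|]; first exact: Ginj Gab Gab'.
  + by move=> [_ bE]; rewrite bE in Gab; have := bN _ Gab.
  + by have := bN _ Gab'.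
  + by move=> [].
Qed.

Lemma in_left_inverse (T : pointedType) (U : Type) (D : set T) (f : T -> U) :
  (forall a a', D a -> D a' -> f a = f a' -> a = a') ->
  exists g : U -> T, forall a, D a -> g (f a) = a.
Proof.
move=> finj.
have /choice[g gP] : forall u : U, exists a : T,
    forall a', D a' -> f a' = u -> a = a'.
  move=> u; have [[a [Da <-]]|nex] := pselect (exists a, D a /\ f a = u).
    by exists a => a' Da' /esym/finj; apply.
  by exists point => a' Da' fa'; case: nex; exists a'.
by exists g => a Da; exact: gP.
Qed.

Lemma infinite_set_neq (T : Type) (D : set T) (x : T) :
  infinite_set D -> exists2 y, D y & y <> x.
Proof.
move=> Dinf; apply: contrapT => /forall2NP Dx; apply: Dinf.
apply: (sub_finite_set _ (finite_set1 x)) => y /= Dy.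
by have [//|/contrapT] := Dx y.
Qed.

(** * Injective pairings on infinite sets *)

Section Square.
Variable T : pointedType.
Implicit Types (D : set T) (p : T -> T -> T) (G : set (T * T * T)).

Definition pairing_on D p :=
  (forall a b, D a -> D b -> D (p a b)) /\
  (forall a b a' b', D a -> D b -> D a' -> D b' -> p a b = p a' b' ->
     a = a' /\ b = b').

Definition pairing_graph D p : set (T * T * T) :=
  [set t | [/\ D t.1.1, D t.1.2 & t.2 = p t.1.1 t.1.2]].

(** Zorn's lemma orders sets by inclusion, so a pairing is encoded by its graph alone; its domain is
    recovered from the diagonal. *)
Definition graph_field G : set T := [set a | exists z, G (a, a, z)].

Definition is_pairing G :=
  [/\ forall a b z, G (a, b, z) ->
        [/\ graph_field G a, graph_field G b & graph_field G z],
      forall a b, graph_field G a -> graph_field G b -> exists z, G (a, b, z),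
      forall a b z z', G (a, b, z) -> G (a, b, z') -> z = z' &
      forall a b a' b' z, G (a, b, z) -> G (a', b', z) -> a = a' /\ b = b'].

Lemma pairing_graph_field D p : graph_field (pairing_graph D p) = D.
Proof.
by apply/seteqP; split=> [a [z []]|a Da] //; exists (p a a).
Qed.

Lemma is_pairing_graph D p : pairing_on D p -> is_pairing (pairing_graph D p).
Proof.
move=> [pD pI]; split; rewrite ?pairing_graph_field.
- by move=> a b _ [/= Da Db ->]; split=> //; exact: pD.
- by move=> a b Da Db; exists (p a b).
- by move=> a b z z' [/= _ _ ->] [/= _ _ ->].
- by move=> a b a' b' z [/= Da Db ->] [/= Da' Db' /pI]; exact.
Qed.

Lemma is_pairingE G : is_pairing G ->
  exists2 p, pairing_on (graph_field G) p & G = pairing_graph (graph_field G) p.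
Proof.
move=> [Gf Gt Gu Gi].
have /choice[q qP] : forall ab : T * T, exists z,
    graph_field G ab.1 -> graph_field G ab.2 -> G (ab, z).
  move=> [a b]; have [[z Gz]|nG] := pselect (exists z, G (a, b, z)).
    by exists z.
  by exists point => /= /Gt{}Gt /Gt.
have {}qP a b : graph_field G a -> graph_field G b -> G (a, b, q (a, b)).
  exact: (qP (a, b)).
exists (fun a b => q (a, b)).
  split=> [a b Da Db|a b a' b' Da Db Da' Db' qq].
    by have [] := Gf _ _ _ (qP _ _ Da Db).
  apply: (Gi a b a' b' (q (a, b))); first exact: qP.
  by rewrite qq; exact: qP.
apply/seteqP; split=> -[[a b] z].
  move=> Gz; have [Da Db _] := Gf _ _ _ Gz; split=> //=.
  by apply: Gu Gz _; exact: qP.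
by move=> [/= Da Db ->]; exact: qP.
Qed.

Lemma pairing_countable : infinite_set [set: T] ->
  exists D p, infinite_set D /\ pairing_on D p.
Proof.
move=> /infiniteP /card_leT_inj[j jI].
have := card_nat2; rewrite card_eq_le => /andP[/card_leT_inj[c cI] _].
have [i iK] := @in_left_inverse nat T setT j (fun a b _ _ => @jI a b).
exists (range j), (fun a b => j (c (i a, i b))); split.
  by apply/infiniteP; rewrite (card_le_eqr (inj_card_eq (in2W jI))).
split=> [a b _ _|_ _ _ _ [a _ <-] [b _ <-] [a' _ <-] [b' _ <-]].
  by exists (c (i a, i b)).
by rewrite !iK // => /jI/cI[-> ->].
Qed.

(** Zorn's lemma is applied above a pairing on a countably infinite set, which keeps the maximal
    domain infinite. *)
Lemma pairing_maximal : infinite_set [set: T] ->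
  exists D p, [/\ infinite_set D, pairing_on D p &
    forall D' p', pairing_on D' p' -> pairing_graph D p `<=` pairing_graph D' p' ->
      D' = D].
Proof.
move=> /pairing_countable[D0 [p0 [D0inf D0p0]]].
have [||G [GP G0G Gmax]] := @Zorn_above _ is_pairing (pairing_graph D0 p0).
- exact: is_pairing_graph.
- move=> F FP F0 Ftot.
  (* Each clause of [is_pairing] starts from at most two triples of the union, and these lie in a
     common member of the chain. *)
  have Fseq (s : seq (T * T * T)) :
      (forall t, t \in s -> (\bigcup_(X in F) X) t) ->
      exists X, [/\ F X, is_pairing X & forall t, t \in s -> X t].
    by move=> /(chain_mem_seq F0 Ftot)[X FX Xs]; exists X; split=> //; exact: FP.
  have field_sub X : F X -> graph_field X `<=` graph_field (\bigcup_(X in F) X).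
    by move=> FX a [z Xz]; exists z; exists X.
  split.
  + move=> a b z [X FX Xz]; have [Xf _ _ _] := FP _ FX.
    by have [? ? ?] := Xf _ _ _ Xz; split; apply: (field_sub _ FX).
  + move=> a b [za Ga] [zb Gb].
    have [|X [FX [_ Xt _ _] Xs]] := Fseq [:: (a, a, za); (b, b, zb)].
      by move=> t; rewrite !inE => /orP[]/eqP->.
    have [||z Xz] := Xt a b; last by exists z; exists X.
      by exists za; apply: Xs; rewrite !inE eqxx.
    by exists zb; apply: Xs; rewrite !inE eqxx orbT.
  + move=> a b z z' Gz Gz'.
    have [|X [FX [_ _ Xu _] Xs]] := Fseq [:: (a, b, z); (a, b, z')].
      by move=> t; rewrite !inE => /orP[]/eqP->.
    by apply: (Xu a b); apply: Xs; rewrite !inE ?eqxx ?orbT.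
  + move=> a b a' b' z Gz Gz'.
    have [|X [FX [_ _ _ Xi] Xs]] := Fseq [:: (a, b, z); (a', b', z)].
      by move=> t; rewrite !inE => /orP[]/eqP->.
    by apply: (Xi a b a' b' z); apply: Xs; rewrite !inE ?eqxx ?orbT.
have [p pP GE] := is_pairingE GP.
exists (graph_field G), p; split=> //.
  apply: sub_infinite_set D0inf => a D0a; exists (p0 a a).
  exact: G0G.
move=> D' p' D'p' GD'.
rewrite -(pairing_graph_field D' p'); congr graph_field.
by apply: Gmax; [exact: is_pairing_graph|rewrite GE].
Qed.

(* A copy of [D] outside of [D] would allow to extend the pairing from [D] to
   the union, since the pairs still to be coded are only [3 |D|^2]. *)
Lemma pairing_maximal_le D p : infinite_set D -> pairing_on D p ->
  (forall D' p', pairing_on D' p' -> pairing_graph D p `<=` pairing_graph D' p' ->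
      D' = D) ->
  ~ (D #<= ~` D).
Proof.
move=> Dinf [pD pI] Dmax /card_le_inj[h hD hI].
have [g gK] := in_left_inverse hI.
have [d0 Dd0] := infinite_setN0 Dinf.
have [d1 Dd1 d1d0] := infinite_set_neq d0 Dinf.
(* A point of [D'] is determined by [tag], which tells whether it lies in [D] or in the copy, and by
   [un], the element of [D] underlying it. *)
pose un x := if pselect (D x) then x else g x.
pose tag x := if pselect (D x) then d0 else d1.
pose D' := D `|` h @` D.
have unE x : D x -> un x = x by rewrite /un; case: pselect.
have tagE x : D x -> tag x = d0 by rewrite /tag; case: pselect.
have unN x : D x -> un (h x) = x.
  move=> Dx; rewrite /un; case: pselect => /= [Dhx|_]; last exact: gK.
  by case: (hD x Dx).
have tagN x : D x -> tag (h x) = d1.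
  by move=> Dx; rewrite /tag; case: pselect => //= Dhx; case: (hD x Dx).
have Dun x : D' x -> D (un x) by move=> [Dx|[y Dy <-]]; [rewrite unE|rewrite unN].
have Dtag x : D (tag x) by rewrite /tag; case: pselect.
have decode x y : D' x -> D' y -> tag x = tag y -> un x = un y -> x = y.
  move=> [Dx|[x' Dx' <-]] [Dy|[y' Dy' <-]].
  - by rewrite !unE.
  - by rewrite tagE // tagN // => /esym/d1d0.
  - by rewrite tagN // tagE // => /d1d0.
  - by rewrite !unN // => _ ->.
pose code x y := p (p (tag x) (tag y)) (p (un x) (un y)).
have Dcode x y : D' x -> D' y -> D (code x y).
  move=> D'x D'y; apply: (pD); apply: (pD); [exact: Dtag|exact: Dtag| |].
    exact: Dun.
  exact: Dun.
have codeI x y x' y' : D' x -> D' y -> D' x' -> D' y' ->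
    code x y = code x' y' -> x = x' /\ y = y'.
  move=> D'x D'y D'x' D'y' /pI[]; try by apply: pD; auto.
  by move=> /pI[]// tx ty /pI[]; auto.
(* Old pairs keep their value in [D] and new ones take values in the copy, so the two kinds never
   collide. Maximality then forces [D' = D], although [h d0] lies in [D'] and not in [D]. *)
pose p' x y := if pselect (D x /\ D y) then p x y else h (code x y).
have pE x y : D x -> D y -> p' x y = p x y.
  by move=> Dx Dy; rewrite /p'; case: pselect => // -[].
have ND : ~ (h d0 \in D) by move=> /set_mem; exact: hD.
apply: ND; rewrite inE -(Dmax D' p').
- by right; exists d0.
- split=> [x y D'x D'y|x y x' y' D'x D'y D'x' D'y'].
    rewrite /p'; case: pselect => /= [[Dx Dy]|_]; first by left; exact: pD.
    by right; exists (code x y) => //; exact: Dcode.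
  rewrite /p'; case: pselect => /= [[Dx Dy]|_]; case: pselect => /= [[Dx' Dy']|_].
  + exact: pI.
  + move=> pE'; have /hD : D (code x' y') by exact: Dcode.
    by rewrite -pE' => /(_ (pD _ _ Dx Dy)).
  + move=> pE'; have /hD : D (code x y) by exact: Dcode.
    by rewrite pE' => /(_ (pD _ _ Dx' Dy')).
  + move=> /hI hE; apply: codeI => //; apply: hE; exact: Dcode.
- move=> [[x y] z] [/= Dx Dy ->]; split=> /=; [by left|by left|].
  by rewrite pE.
Qed.

Lemma exists_pairing : infinite_set [set: T] -> exists p, pairing_on setT p.
Proof.
move=> /pairing_maximal[D [p [Dinf Dp Dmax]]].
have [/card_le_inj[h hD hI]|/(pairing_maximal_le Dinf Dp Dmax)//] :=
  card_le_total (~` D) D.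
have [pD pI] := Dp.
have [d0 Dd0] := infinite_setN0 Dinf.
have [d1 Dd1 d1d0] := infinite_set_neq d0 Dinf.
(* The complement of [D] injects into [D], so all of [T] does: the first coordinate [d0] or [d1]
   separates the two cases. The pairing of [D] is then pulled back along [f]. *)
pose f x := if pselect (D x) then p d0 x else p d1 (h x).
have Df x : D (f x).
  by rewrite /f; case: pselect => /= [Dx|/hD Dh]; exact: pD.
have fI : injective f.
  move=> x y; rewrite /f; case: pselect => /= Dx; case: pselect => /= Dy.
  - by move=> /pI[].
  - by have hDy := hD _ Dy; move=> /pI[]// /esym/d1d0.
  - by have hDx := hD _ Dx; move=> /pI[]// /d1d0.
  - have [hDx hDy] := (hD _ Dx, hD _ Dy).
    by move=> /pI[]// _ /hI; apply.
exists (fun x y => p (f x) (f y)); split=> // x y x' y' _ _ _ _ /pI[]//.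
by move=> /fI -> /fI ->.
Qed.

End Square.

Lemma exists_pairing_fun (T : Type) : infinite_set [set: T] ->
  exists p : T -> T -> T, forall a b a' b', p a b = p a' b' -> a = a' /\ b = b'.
Proof.
elim/Ppointed: T => T Tinf.
  by have [x] := infinite_setN0 Tinf; have := no x.
have [p [_ pI]] := exists_pairing Tinf.
by exists p => a b a' b'; exact: pI.
Qed.

(** * Arithmetic of infinite cardinals *)

Lemma card_setX_self (T : Type) :
  infinite_set [set: T] -> [set: T * T] #<= [set: T].
Proof.
move=> /exists_pairing_fun[p pI].
apply: (@inj_card_leT _ _ (fun ab => p ab.1 ab.2)) => -[a b] [a' b'] /=.
by move=> /pI[-> ->].
Qed.

Lemma card_prod_le (T T' U U' : Type) :
  [set: T] #<= [set: T'] -> [set: U] #<= [set: U'] ->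
  [set: T * U] #<= [set: T' * U'].
Proof.
move=> /card_leT_inj[f fI] /card_leT_inj[g gI].
apply: (@inj_card_leT _ _ (fun ab => (f ab.1, g ab.2))) => -[a b] [a' b'] /=.
by move=> [/fI -> /gI ->].
Qed.

Lemma card_seq_self (T : Type) :
  infinite_set [set: T] -> [set: seq T] #<= [set: T].
Proof.
move=> Tinf; have [p pI] := exists_pairing_fun Tinf.
have [t _] := infinite_setN0 Tinf.
have /infiniteP/card_leT_inj[c cI] := Tinf.
(* The fold alone need not separate sequences of different lengths, so the length is coded too. *)
apply: (@inj_card_leT _ _ (fun s => p (c (size s)) (foldr p t s))).
move=> s s' /pI[/cI ss']; elim: s s' ss' => [|x s IHs] [|x' s'] //= [ss'].
by move=> /pI[-> /IHs ->].
Qed.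

Lemma card_seq_le (T U : Type) :
  [set: T] #<= [set: U] -> [set: seq T] #<= [set: seq U].
Proof.
by move=> /card_leT_inj[f fI]; apply: (@inj_card_leT _ _ (map f)); exact: inj_map.
Qed.

(** Cantor's diagonal argument, with the set of those [f B] that do not belong to [B]. *)
Lemma card_set_gt (T : Type) : ~~ ([set: set T] #<= [set: T]).
Proof.
apply/negP => /card_leT_inj[f fI].
pose A := [set x | exists2 B, f B = x & ~ B x].
have nA : ~ A (f A) by move=> /[dup] AA [B /fI ->].
by apply: (nA); exists A.
Qed.

Lemma card_set_ge (T : Type) : [set: T] #<= [set: set T].
Proof.
apply: (@inj_card_leT _ _ set1) => x y xy.
by have : [set y] x by rewrite -xy.
Qed.

Lemma card_setU_le (V S : Type) (A B : set V) : infinite_set [set: S] ->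
  A #<= [set: S] -> B #<= [set: S] -> A `|` B #<= [set: S].
Proof.
elim/Ppointed: S => S Sinf; first by have [x] := infinite_setN0 Sinf; have := no x.
move=> /card_le_inj[f _ fI] /card_le_inj[h _ hI].
apply: card_le_trans (card_setX_self Sinf).
have /card_leT_inj[b bI] : [set: bool] #<= [set: S].
  apply: (@card_le_trans _ _ _ [set: nat]); first exact: countableP.
  exact/infiniteP.
(* The tags [b true] and [b false] keep the two images apart. A point of both [A] and [B] has two
   codes, which a relation allows. *)
apply: (@card_le_rel _ _ _ _ (fun v (p : S * S) =>
  (A v /\ p = (b true, f v)) \/ (B v /\ p = (b false, h v)))).
  by move=> v [Av|Bv]; [exists (b true, f v) => //; left
                       |exists (b false, h v) => //; right].
move=> v v' p [[Av ->]|[Bv ->]] [[Av' []]|[Bv' []]].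
- by move=> ?; exact: fI.
- by move=> /bI.
- by move=> /bI.
- by move=> ?; exact: hI.
Qed.

(** * Linear independence modulo a subspace *)

Section Combinations.
Variables (K : fieldType) (V : lmodType K).
Implicit Types (B C W : set V) (l : seq (V * K)) (v w : V).

(** Lists may repeat a vector, so sums and multiples of combinations are plain concatenations and
    rescalings, without merging of supports. The map [f] serves to transport a combination to
    another space. *)
Definition comb (U : lmodType K) (f : V -> U) l : U :=
  \sum_(p <- l) p.2 *: f p.1.

Definition coef l v : K := \sum_(p <- l | p.1 == v) p.2.

Definition comb_supp l : {fset V} := [fset v in map fst l]%fset.

Definition comb_in B l := forall p, p \in l -> B p.1.

Definition fset_comb (s : {fset V}) (c : V -> K) : seq (V * K) :=
  [seq (v, c v) | v <- s].

(** Merging repeated vectors leads back to the finite sets used by [lin_span] and [lin_indep]. *)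
Lemma comb_collect (U : lmodType K) (f : V -> U) l :
  comb f l = \sum_(v <- comb_supp l) coef l v *: f v.
Proof.
under eq_bigr do rewrite /coef scaler_suml.
rewrite (exchange_big_dep xpredT) //= /comb big_seq [RHS]big_seq.
apply: eq_bigr => p pl; under eq_bigl do rewrite eq_sym.
rewrite (fbig_pred1_inj (k := id)) //.
by rewrite !inE; exact: map_f.
Qed.

Lemma comb_in_supp B l : comb_in B l -> [set` comb_supp l] `<=` B.
Proof. by move=> lB v /=; rewrite !inE /= => /mapP[p /lB Bp ->]. Qed.

Lemma fset_combE (U : lmodType K) (f : V -> U) s c :
  comb f (fset_comb s c) = \sum_(v <- s) c v *: f v.
Proof. by rewrite /comb big_map. Qed.

Lemma fset_comb_in B s c : [set` s] `<=` B -> comb_in B (fset_comb s c).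
Proof. by move=> sB _ /mapP[v vs ->]; exact: sB. Qed.

Lemma comb_cat (U : lmodType K) (f : V -> U) l l' :
  comb f (l ++ l') = comb f l + comb f l'.
Proof. exact: big_cat. Qed.

Definition scale_comb (a : K) l := [seq (p.1, a * p.2) | p <- l].

Lemma comb_scale (U : lmodType K) (f : V -> U) a l :
  comb f (scale_comb a l) = a *: comb f l.
Proof.
by rewrite /comb big_map scaler_sumr; apply: eq_bigr => p _ /=; rewrite scalerA.
Qed.

Lemma comb_in_cat B l l' : comb_in B l -> comb_in B l' -> comb_in B (l ++ l').
Proof. by move=> lB l'B p; rewrite mem_cat => /orP[/lB|/l'B]. Qed.

Lemma comb_in_scale B a l : comb_in B l -> comb_in B (scale_comb a l).
Proof. by move=> lB _ /mapP[p /lB Bp ->]. Qed.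

Lemma lin_spanP B w : lin_span B w <-> exists2 l, comb_in B l & w = comb id l.
Proof.
split=> [[s [c [sB ->]]]|[l lB ->]].
  by exists (fset_comb s c); [exact: fset_comb_in|rewrite fset_combE].
exists (comb_supp l), (coef l); split; first exact: comb_in_supp.
exact: comb_collect.
Qed.

Lemma lin_span_subspace B : lin_subspace (lin_span B).
Proof.
split=> [|a u v].
  by apply/mem_set/lin_spanP; exists [::]; rewrite /comb ?big_nil.
move=> /set_mem/lin_spanP[l lB ->] /set_mem/lin_spanP[l' l'B ->].
apply/mem_set/lin_spanP; exists (scale_comb a l ++ l').
  by apply: comb_in_cat => //; exact: comb_in_scale.
by rewrite comb_cat comb_scale.
Qed.

Lemma lin_spanS B B' : B `<=` B' -> lin_span B `<=` lin_span B'.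
Proof.
by move=> BB' _ [s [c [sB ->]]]; exists s, c; split=> //; exact: subset_trans BB'.
Qed.

(* Linear independence of the classes of the elements of [B] in [V / C]. *)
Definition indep_mod C B := forall (s : {fset V}) (c : V -> K),
  [set` s] `<=` B -> C (\sum_(v <- s) c v *: v) -> forall v, v \in s -> c v = 0.

Lemma indep_mod_sub C B B' : B `<=` B' -> indep_mod C B' -> indep_mod C B.
Proof. by move=> BB' ind s c sB; apply: ind; exact: subset_trans BB'. Qed.

Lemma indep_mod_lin C B : C 0 -> indep_mod C B -> lin_indep B.
Proof. by move=> C0 ind s c sB sc0; apply: ind => //; rewrite sc0. Qed.

Lemma lin_indep_mod C B : lin_indep B -> lin_span B `&` C `<=` [set 0] ->
  indep_mod C B.
Proof.
move=> ind BC s c sB Csc; apply: ind => //.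
by apply: BC; split=> //; exists s, c.
Qed.

Lemma indep_mod_span C B : indep_mod C B -> lin_span B `&` C `<=` [set 0].
Proof.
move=> ind _ [[s [c [sB ->]]] Csc] /=.
by rewrite big_seq big1 // => v /(ind _ _ sB Csc) ->; rewrite scale0r.
Qed.

(** After merging, all coefficients vanish. This is what makes the linear extension of a map on a
    basis well defined. *)
Lemma indep_comb0 (U : lmodType K) (f : V -> U) B l :
  lin_indep B -> comb_in B l -> comb id l = 0 -> comb f l = 0.
Proof.
move=> ind lB; rewrite !comb_collect => l0.
rewrite big_seq big1 // => v vl.
by rewrite (ind _ _ (comb_in_supp lB) l0) ?scale0r.
Qed.

Lemma indep_neq0 B v : lin_indep B -> B v -> v <> 0.
Proof.
move=> ind Bv v0.
suff /eqP : 1 = 0 :> K by rewrite oner_eq0.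
apply: (ind [fset v]%fset (fun=> 1) _ _ v (fset11 v)).
  by move=> w /=; rewrite inE => /eqP ->.
by rewrite big_seq_fset1 scale1r.
Qed.

(** Independence modulo [C] concerns finite subsets only, so it passes to unions of chains and
    Zorn's lemma applies. *)
Lemma extend_indep_mod C B : indep_mod C B ->
  exists G, [/\ indep_mod C G, B `<=` G &
    forall G', indep_mod C G' -> G `<=` G' -> G' = G].
Proof.
move=> Bind; apply: Zorn_above => // F FP F0 Ftot s c sF Csc v vs.
have [X FX sX] := chain_mem_seq (s := s) F0 Ftot (fun v vs => sF v vs).
exact: FP _ FX s c sX Csc v vs.
Qed.

(** If [v] is not in [G], adding it creates a relation modulo [C]. Its coefficient at [v] is nonzero
    by independence of [G], so the relation can be solved for [v]. *)
Lemma maximal_indep_mod_span C G : lin_subspace C -> indep_mod C G ->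
  (forall G', indep_mod C G' -> G `<=` G' -> G' = G) ->
  forall v, exists2 l, comb_in G l & C (v - comb id l).
Proof.
move=> [/set_mem C0 Clin] Gind Gmax v.
have [Gv|nGv] := pselect (G v).
  exists [:: (v, 1)]; first by move=> p; rewrite inE => /eqP ->.
  by rewrite /comb big_seq1 scale1r subrr.
have : ~ indep_mod C (v |` G).
  by move=> /Gmax H; apply: nGv; rewrite -H; [left|move=> x; right].
move=> /existsNP[s /existsNP[c /not_implyP[sG /not_implyP[Csc]]]].
move=> /existsNP[u /not_implyP[us cu]].
have sG' w : w \in s -> w != v -> G w.
  by move=> ws wv; have [/eqP|//] := sG w ws; rewrite (negbTE wv).
have vs : v \in s.
  apply: contrapT => /negP vs; apply: cu; apply: (Gind s c) => // w ws.
  by apply: sG' => //; apply: contraNneq vs => <-.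
pose s' := (s `\ v)%fset.
have s'G : [set` s'] `<=` G.
  by move=> w /=; rewrite !inE => /andP[wv ws]; exact: sG'.
have sE : \sum_(w <- s) c w *: w = c v *: v + \sum_(w <- s') c w *: w.
  by rewrite (big_fsetD1 v).
have cv : c v != 0.
  apply/eqP => cv0; apply: cu.
  have [->//|uv] := eqVneq u v.
  apply: (Gind s' c) => //; last by rewrite !inE uv.
  by move: Csc; rewrite sE cv0 scale0r add0r.
exists (scale_comb (- (c v)^-1) (fset_comb s' c)).
  by apply: comb_in_scale; exact: fset_comb_in.
rewrite comb_scale fset_combE scaleNr opprK.
have := Clin (c v)^-1 _ 0 (mem_set Csc) (mem_set C0).
by rewrite addr0 sE scalerDr scalerA mulVf // scale1r => /set_mem.
Qed.

(* Elements of [V] that are distinct modulo [C] are coded by distinct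
   combinations of elements of [G]. *)
Lemma card_le_maximal_indep_mod C G (S : Type) (x : S -> V) :
  lin_subspace C -> indep_mod C G ->
  (forall G', indep_mod C G' -> G `<=` G' -> G' = G) ->
  (forall s t, C (x s - x t) -> s = t) ->
  infinite_set [set: K] -> ~~ ([set: S] #<= [set: K]) ->
  [set: S] #<= G.
Proof.
move=> Csub Gind Gmax xinj Kinf KS.
have Glist l : comb_in G l ->
    exists l' : seq (G * K), l = [seq (val p.1, p.2) | p <- l'].
  elim: l => [|[v a] l IHl] lG; first by exists [::].
  have [|l' ->] := IHl; first by move=> p pl; apply: lG; rewrite inE pl orbT.
  by exists ((SigSub (mem_set (lG _ (mem_head _ _))), a) :: l').
have S_le : [set: S] #<= [set: seq (G * K)].
  apply: (@card_le_rel _ _ _ _ (fun s (l' : seq (G * K)) =>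
    C (x s - comb id [seq (val p.1, p.2) | p <- l']))).
    move=> s _; have [l /Glist[l' ->] Cl] :=
      maximal_indep_mod_span Csub Gind Gmax (x s).
    by exists l'.
  move=> s t l' Cs Ct; apply: xinj; have [_ Clin] := Csub.
  have := Clin (-1) _ _ (mem_set Ct) (mem_set Cs).
  rewrite scaleN1r opprB addrC addrA subrK => /set_mem; exact.
rewrite -(card_le_eqr (card_setT G)).
have infle (T U : Type) : infinite_set [set: T] -> [set: T] #<= [set: U] ->
    infinite_set [set: U].
  by move=> Tinf TU Ufin; apply: Tinf; exact: card_le_finite Ufin.
have Sle (T : Type) : infinite_set [set: T] -> [set: G] #<= [set: T] ->
    [set: K] #<= [set: T] -> [set: S] #<= [set: T].
  move=> Tinf GT KT; apply: card_le_trans S_le _.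
  apply: card_le_trans (card_seq_self Tinf).
  apply: card_seq_le; apply: card_le_trans (card_setX_self Tinf).
  exact: card_prod_le.
(* By [Sle], an infinite set dominating both [G] and [K] dominates [S]. It cannot be [K], so [K] is
   dominated by [G], and [G] is the set wanted. *)
have [GK|KG] := card_le_total [set: G] [set: K].
  by move: KS; rewrite Sle.
by apply: Sle => //; exact: infle KG.
Qed.

(** The family [x] picks representatives of distinct classes, so it witnesses that the quotient of
    [V] by [C] has at least as many elements as [S]. *)
Lemma extend_transversal C (S gamma : Type) (x : S -> V) W :
  lin_subspace C -> (forall s t, C (x s - x t) -> s = t) ->
  infinite_set [set: K] -> card_lt K S ->
  [set: gamma] #<= [set: S] -> has_dim W gamma -> W `&` C `<=` [set 0] ->
  exists W', [/\ lin_subspace W', has_dim W' S, W `<=` W' &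
    W' `&` C `<=` [set 0]].
Proof.
move=> Csub xinj Kinf /andP[KS SK] gS [B [Bind BW] Bg] WC.
have C0 : C 0 by have [/set_mem] := Csub.
have Sinf : infinite_set [set: S].
  by move=> Sfin; apply: Kinf; exact: card_le_finite Sfin.
have [|G [Gind BG Gmax]] := @extend_indep_mod C B.
  by apply: lin_indep_mod => //; rewrite BW.
have SG := card_le_maximal_indep_mod Csub Gind Gmax xinj Kinf SK.
(* Adjoining [B] to [H] puts [W] inside the span, and the size stays that of [S] because [B] is no
   larger. *)
have /card_subP[H HS HG] := SG.
have BHG : B `|` H `<=` G by move=> v [/BG|/HG].
have BHind := indep_mod_sub BHG Gind.
exists (lin_span (B `|` H)); split.
- exact: lin_span_subspace.
- exists (B `|` H); first by split=> //; exact: indep_mod_lin BHind.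
  rewrite card_eq_le; apply/andP; split; last first.
    rewrite -(card_le_eql HS); exact: subset_card_le.
  by apply: card_setU_le; rewrite ?(card_le_eql Bg) ?(card_le_eql HS).
- by rewrite -BW; apply: lin_spanS; left.
- exact: indep_mod_span.
Qed.

Lemma linear_extension (U : lmodType K) B (g : V -> U) :
  hamel_basis setT B -> exists f : V -> U, linear f /\ forall v, B v -> f v = g v.
Proof.
move=> [Bind BT].
(* One expansion of each vector is chosen; [combE] shows that the value computed from it does not
   depend on the choice. *)
have /choice[l lP] : forall v, exists l, comb_in B l /\ v = comb id l.
  move=> v; have : lin_span B v by rewrite BT.
  by move=> /lin_spanP[l ? ?]; exists l.
have combE l1 l2 : comb_in B l1 -> comb_in B l2 -> comb id l1 = comb id l2 ->
    comb g l1 = comb g l2.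
  move=> l1B l2B l12.
  have /(indep_comb0 g Bind) : comb_in B (l1 ++ scale_comb (-1) l2).
    by apply: comb_in_cat => //; exact: comb_in_scale.
  rewrite !comb_cat !comb_scale l12 !scaleN1r subrr => /(_ erefl)/eqP.
  by rewrite subr_eq0 => /eqP.
exists (fun v => comb g (l v)); split=> [a u v|v Bv].
  rewrite -comb_scale -comb_cat; apply: combE; first by have [] := lP (a *: u + v).
    apply: comb_in_cat; last by have [] := lP v.
    by apply: comb_in_scale; have [] := lP u.
  rewrite comb_cat comb_scale.
  by have [_ <-] := lP (a *: u + v); have [_ <-] := lP u; have [_ <-] := lP v.
rewrite (combE _ [:: (v, 1)]); first by rewrite /comb big_seq1 scale1r.
- by have [] := lP v.
- by move=> p; rewrite inE => /eqP ->.
- by have [_ <-] := lP v; rewrite /comb big_seq1 scale1r.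
Qed.

Lemma has_dim_sub (S gamma : Type) (W : set V) :
  has_dim W S -> [set: gamma] #<= [set: S] ->
  exists W', [/\ lin_subspace W', has_dim W' gamma & W' `<=` W].
Proof.
move=> [B [Bind BW] BS] gS.
have /card_subP[H Hg HB] : [set: gamma] #<= B by rewrite (card_le_eqr BS).
exists (lin_span H); split; first exact: lin_span_subspace.
  exists H; last by [].
  split=> // s c sH; apply: Bind; exact: subset_trans HB.
by rewrite -BW; exact: lin_spanS.
Qed.

Lemma has_dim0 : has_dim [set 0 : V] void.
Proof.
have void0 : [set: void] = set0 by apply/seteqP; split=> -[].
exists set0; last by rewrite void0 card_eq00.
split.
  by move=> s c s0 _ v /s0.
apply/seteqP; split=> [_ [s [c [s0 ->]]]|_ ->] /=.
  by rewrite big_seq big1 // => v /s0.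
by exists fset0, (fun=> 0); split; [move=> v /=; rewrite inE|rewrite big_nil].
Qed.

End Combinations.

(** * Discontinuous multilinear maps *)

Lemma infinite_numField (K : numFieldType) : infinite_set [set: K].
Proof.
apply/infiniteP/(@inj_card_leT _ _ (fun n => n%:R)) => a b /eqP.
by rewrite eqr_nat => /eqP.
Qed.

Section ProductMultilinear.
Variables (K : fieldType) (m : nat) (E F : lmodType K).
Variables (psi : 'I_m -> E -> K) (y0 : F).
Hypothesis psi_lin : forall j a u v, psi j (a *: u + v) = a * psi j u + psi j v.

Lemma prod_multilinear :
  (fun x => (\prod_j psi j (x j)) *: y0) \in @multilinear_pred K m E F.
Proof.
apply/asboolP => i x a u v.
(* Only the factor of index [i] depends on the [i]-th argument. *)
have prodE t : \prod_j psi j (@dfwith _ (fun=> E) x i t j) =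
    psi i t * \prod_(j | j != i) psi j (x j).
  rewrite (bigD1 i) //= dfwithin; congr (_ * _).
  by apply: eq_bigr => j ji; rewrite dfwithout // eq_sym.
by rewrite !prodE psi_lin mulrDl scalerDl -mulrA scalerA.
Qed.

Definition prod_mlin : mlin m E F := MLin prod_multilinear.

End ProductMultilinear.

Section Continuity.
Variables (R : realType) (m : nat) (E F : normedModType R).

Lemma mlin_funD (a : R) (f g : mlin m E F) x :
  (a *: f + g : mlin m E F) x = a *: f x + g x.
Proof. by []. Qed.

Lemma mlin_fun0 : (0 : mlin m E F) =1 (fun=> 0).
Proof. by []. Qed.

Definition continuous_mlin : set (mlin m E F) :=
  [set f : mlin m E F | continuous (f : {ptws 'I_m -> E} -> F)].

Lemma eq_continuous_mlin (f : mlin m E F) (g : {ptws 'I_m -> E} -> F) :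
  f =1 g -> continuous g -> continuous_mlin f.
Proof. by move=> /funext fg; rewrite /continuous_mlin /mkset fg. Qed.

Lemma continuous_mlin_subspace : lin_subspace continuous_mlin.
Proof.
split=> [|a f g /set_mem fC /set_mem gC]; apply/mem_set.
  exact: (eq_continuous_mlin mlin_fun0 (@cst_continuous _ _ _)).
apply: (eq_continuous_mlin (mlin_funD a f g)) => x.
apply: (@cvgD R F _ (nbhs x) _ (fun y => a *: f y) g); last exact: gC.
apply: (@cvgZl_tmp R F _ (nbhs x)); exact: fC.
Qed.

Lemma noncontinuous_mlin_sub (W : set (mlin m E F)) :
  W `<=` noncontinuous_mlin m E F `|` [set 0] <->
  W `&` continuous_mlin `<=` [set 0].
Proof.
split=> [WA f [/WA[]//]|WC f Wf].
have [fC|fC] := pselect (continuous_mlin f); last by left.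
by right; exact: WC.
Qed.

(** The [i]-th argument runs through a null sequence along which [D] keeps the value [y], whereas
    continuity would force the limit [0]. *)
Lemma discontinuous_mlin (D : mlin m E F) (i : 'I_m) (x : 'I_m -> E)
    (t : nat -> E) (y : F) :
  (forall n, `|t n| = n.+1%:R^-1) ->
  (forall n, D (@dfwith _ (fun=> E) x i (t n)) = y) ->
  y != 0 -> ~ continuous_mlin D.
Proof.
move=> tn Dy y0 Dcont.
have t0 : t @ \oo --> (0 : E).
  apply/norm_cvg0P; under eq_fun do rewrite tn.
  exact: cvg_harmonic.
pose d : E -> {ptws 'I_m -> E} := @dfwith _ (fun=> E) x i.
have dcont : continuous d by exact: (@dfwith_continuous _ (fun=> E)).
have cvgd : (d \o t) n @[n --> \oo] --> d 0.
  exact: (@continuous_cvg _ _ _ _ _ t d 0 (dcont 0) t0).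
have cvgy : D (d (t n)) @[n --> \oo] --> D (d 0).
  exact: (@continuous_cvg _ _ _ _ _ (d \o t) D (d 0) (Dcont _) cvgd).
have Dd0 : D (d 0) = 0.
  have /asboolP/(_ i x) := mlin_funP D.
  by move=> /(_ (-1) 0 0) /=; rewrite scaler0 addr0 scaleN1r addNr.
have yE : (fun n => D (d (t n))) = (fun=> y) by apply/funext => n; exact: Dy.
move: cvgy; rewrite yE Dd0 => /(@cvg_lim _ (@norm_hausdorff _ F) _ _ _ _ _).
by rewrite lim_cst //; apply/eqP.
Qed.

End Continuity.

Lemma has_dim_neq0 (K : fieldType) (V : lmodType K) (W : set V) (S : Type) :
  has_dim W S -> [set: S] !=set0 -> exists v : V, v != 0.
Proof.
move=> [B [Bind _] BS] S0.
have [v Bv] : B !=set0.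
  apply/set0P; apply: contraTneq BS => B0.
  by rewrite B0 card_eq_sym card_eq0; apply/set0P.
by exists v; apply/eqP; exact: indep_neq0 Bv.
Qed.

(** * Multilinear maps indexed by sets of basis sequences *)

Section DiscontinuousFamily.
Variables (R : realType) (m : nat) (E F : normedModType R) (I : Type).

Lemma discontinuous_family (i0 : 'I_m) (y : F) :
  has_dim [set: E] I -> infinite_set [set: I] -> y != 0 ->
  exists x : set I -> mlin m E F,
    forall A A', continuous_mlin (x A - x A') -> A = A'.
Proof.
move=> [B [Bind BE] BI] Iinf y0.
(* The basis vectors [k (i, n)], for fixed [i], form the sequence of index [i]; all these vectors
   are distinct. *)
have [k kB kI] : exists2 k : I * nat -> E, (forall p, B (k p)) & injective k.
  have : [set: I * nat] #<= B.
    rewrite (card_le_eqr BI); apply: card_le_trans (card_setX_self Iinf).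
    by apply: card_prod_le => //; exact/infiniteP.
  move=> /card_le_inj[k kB kI]; exists k => [p|p q]; first exact: kB.
  exact: kI.
have k_neq0 p : `|k p| != 0.
  by rewrite normr_eq0; apply/eqP; exact: indep_neq0 (kB p).
(* On normalised vectors of a sequence in [A] the functional takes the values [n.+1], hence is
   unbounded. *)
have phi_ex (A : set I) : exists phi : E -> R^o, linear phi /\
    forall p, phi (k p) = if p.1 \in A then p.2.+1%:R * `|k p| else 0.
  have /choice[g gP] : forall v, exists r : R^o, forall p, k p = v ->
      r = if p.1 \in A then p.2.+1%:R * `|k p| else 0.
    move=> v; have [[p kp]|nk] := pselect (exists p, k p = v).
      exists (if p.1 \in A then p.2.+1%:R * `|k p| else 0) => q kq.
      by have -> : q = p by apply: kI; rewrite kq.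
    by exists 0 => p kp; case: nk; exists p.
  have [phi [phi_lin phiE]] := linear_extension g (conj Bind BE).
  by exists phi; split=> // p; rewrite phiE //; exact: gP.
have [phi phiP] := choice phi_ex.
have [i1 _] := infinite_setN0 Iinf.
have [one [one_lin one1]] := linear_extension (fun=> 1 : R^o) (conj Bind BE).
pose psi A j := if j == i0 then phi A else one.
have psi_lin A j a u v : psi A j (a *: u + v) = a * psi A j u + psi A j v.
  by rewrite /psi; case: eqP => _; [have [-> _] := phiP A|rewrite one_lin].
pose x A := prod_mlin y (psi_lin A).
(* Any basis vector serves as base point: [one] equals 1 there, so the factors other than the one at
   [i0] disappear. *)
pose c : 'I_m -> E := fun=> k (i1, 0%N).
have xE (A : set I) t : x A (@dfwith _ (fun=> E) c i0 t) = phi A t *: y.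
  rewrite /x /= (bigD1 i0) //= dfwithin {1}/psi eqxx big1 ?mulr1 // => j ji.
  by rewrite /psi (negbTE ji) dfwithout 1?eq_sym // one1 //; exact: kB.
exists x => A A' cont; apply: contrapT => AA'.
have [i Ai] : exists i, (i \in A) != (i \in A').
  apply: contrapT => /forallNP AA; apply: AA'; apply/seteqP.
  by split=> i; have /negP := AA i; rewrite negbK => /eqP Ai /mem_set Hi;
    apply: set_mem; first [by rewrite Ai | by rewrite -Ai].
(* The scaling gives [t n] norm [n.+1%:R^-1] while [phi A1 (t n)] is 1 or 0 according to whether [i]
   is in [A1]. As [i] separates [A] from [A'], the difference of the two maps is constantly [y] or
   [- y] along [t]. *)
pose t n := (n.+1%:R * `|k (i, n)|)^-1 *: k (i, n).
have phit (A1 : set I) n : phi A1 (t n) = (i \in A1)%:R.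
  have [phi_lin phiE] := phiP A1.
  have phi0 : phi A1 0 = 0.
    by have := phi_lin (-1) 0 0; rewrite scaler0 addr0 scaleN1r addNr.
  rewrite /t -[X in phi A1 X]addr0 phi_lin phi0 addr0 phiE /=.
  case: ifP => _; last by rewrite scaler0.
  by rewrite -[_ *: _]/(_ * _) mulVf // mulf_neq0 // pnatr_eq0.
apply: (@discontinuous_mlin _ _ _ _ (x A - x A') i0 c t
    (((i \in A)%:R - (i \in A')%:R) *: y)) cont.
- move=> n; rewrite normrZ normfV ger0_norm ?mulr_ge0 ?ler0n //.
  by rewrite invfM -mulrA mulVf ?mulr1.
- move=> n; rewrite -[LHS]/(x A _ - x A' _) !xE -scalerBl.
  by rewrite !phit.
- rewrite scaler_eq0 negb_or y0 andbT subr_eq0 eqr_nat.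
  by move: Ai; do 2!case: (i \in _).
Qed.

End DiscontinuousFamily.

Theorem theorem2p10 (R : realType) (E F : normedModType R) (m : nat)
    (dimE dimF : Type) :
  (0 < m)%N ->
  has_dim [set: E]%classic dimE -> has_dim [set: F]%classic dimF ->
  card_lt R dimE -> card_lt dimE dimF ->
  forall gamma : Type, card_lt gamma dimE ->
    lineable2 gamma (set dimE) (noncontinuous_mlin m E F).
Proof.
move=> m0 dE dF /andP[RE ER] /andP[EF FE] gamma /andP[gE Eg].
have Einf : infinite_set [set: dimE].
  by move=> Efin; apply: (@infinite_numField R); exact: card_le_finite Efin.
have [y y0] : exists y : F, y != 0.
  apply: has_dim_neq0 dF _; apply/set0P; apply: contraNneq FE => ->.
  exact: card_ge0.
have [x xinj] := discontinuous_family (Ordinal m0) dE Einf y0.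
have gS : [set: gamma] #<= [set: set dimE].
  exact: card_le_trans gE (card_set_ge dimE).
have RS : card_lt R (set dimE).
  rewrite /card_lt (card_le_trans RE (card_set_ge dimE)) /=.
  apply: contra ER => SR; exact: card_le_trans (card_set_ge dimE) SR.
have extend S W := @extend_transversal _ _ _ _ S x W
  (@continuous_mlin_subspace R m E F) xinj (@infinite_numField R) RS.
split.
- rewrite /card_lt gS /=; apply: contra (card_set_gt dimE) => Sg.
  exact: card_le_trans Sg gE.
(* Plain lineability comes from extending the zero subspace and then cutting the result down to
   dimension [gamma]. *)
- have [||W [_ WS _ WC]] := extend void [set 0] _ (has_dim0 _).
  + by have -> : [set: void] = set0; [apply/seteqP; split=> -[]|exact: card_ge0].
  + by move=> f [].
  have [W' [W'sub W'g W'W]] := has_dim_sub WS gS.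
  exists W'; split=> //; apply/noncontinuous_mlin_sub.
  by apply: subset_trans WC; exact: setSI.
- move=> W Wsub /noncontinuous_mlin_sub WC Wg.
  have [W' [W'sub W'S WW' W'C]] := extend gamma W gS Wg WC.
  by exists W'; split=> //; apply/noncontinuous_mlin_sub.
Qed.
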